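(* Let $c\in\mathbb{R}$ with $|c|<1$, let $\pi$ be the standard $SU(2)$-invariant Poisson structure on the unit sphere $S^2\subset\mathbb{R}^3$, and let $\pi_c=(c-x_3)\,\pi$. Then the class of $\pi$ in the Poisson cohomology space $H^2_{\pi_c}(S^2)$ is nonzero.
   Context: Let $S^2=\{x_1^2+x_2^2+x_3^2=1\}\subset\mathbb{R}^3$. The standard $SU(2)$-invariant (i.e. rotation-invariant) Poisson structure $\pi$ is the nondegenerate Poisson bivector field on $S^2$ such that $-\pi$ is the restriction to $S^2$ of $x_1\,\partial_{x_2}\wedge\partial_{x_3}+x_2\,\partial_{x_3}\wedge\partial_{x_1}+x_3\,\partial_{x_1}\wedge\partial_{x_2}$. In the stereographic coordinate $w=x+iy=(x_1-ix_2)/(1+x_3)$ on $S^2\setminus\{(0,0,-1)\}$ one has $\pi=\frac14(1+x^2+y^2)^2\,\partial_x\wedge\partial_y$ and $x_3=\frac{1-x^2-y^2}{1+x^2+y^2}$. For $|c|<1$, the Poisson bivector field $\pi_c=(c-x_3)\pi$ vanishes exactly on the circle $\{x_3=c\}$. For a Poisson manifold $(P,\pi_P)$, the Poisson cohomology $H^\bullet_{\pi_P}(P)$ is the cohomology of the complex $(\mathfrak{X}^\bullet(P),d_{\pi_P}=[\pi_P,\cdot])$, where $\mathfrak{X}^k(P)$ is the space of smooth $k$-vector fields on $P$ and $[\cdot,\cdot]$ is the Schouten bracket. On a surface every bivector field is a $2$-cocycle. *)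

(* Defs.v *)
From HB Require Import structures.
From mathcomp Require Import all_boot all_order all_fingroup all_algebra.
From mathcomp Require Import all_classical all_reals all_analysis.

Set Implicit Arguments.
Unset Strict Implicit.
Unset Printing Implicit Defensive.

Import Order.TTheory GRing.Theory Num.Theory.
Import numFieldNormedType.Exports.

Local Open Scope classical_set_scope.
Local Open Scope ring_scope.

Section Sphere.
Variable R : realType.

(* The norm that the library puts on ['rV_3] is the sup norm; [sqnorm] is the
   square of the Euclidean one. *)
Definition sqnorm (x : 'rV[R]_3) : R := \sum_(i < 3) x 0 i ^+ 2.

Definition sphere : Type := {x : 'rV[R]_3 | sqnorm x == 1}.

Definition xcoord (i : 'I_3) (p : sphere) : R := val p 0 i.

(* C^oo on the open set U: all iterated directional derivatives exist and are
   differentiable, hence continuous, on U. *)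
Definition smooth_on (U : set 'rV[R]_3) (F : 'rV[R]_3 -> R) : Prop :=
  forall (vs : seq 'rV[R]_3) (x : 'rV[R]_3), U x ->
    differentiable (foldr (fun v G => 'D_v G) F vs) x.

(* Smooth functions on the submanifold S^2 of R^3: locally the restriction of
   a smooth function on an open subset of R^3. *)
Definition smooth (f : sphere -> R) : Prop :=
  forall p : sphere, exists (U : set 'rV[R]_3) (F : 'rV[R]_3 -> R),
    [/\ open U, U (val p), smooth_on U F &
        forall q : sphere, U (val q) -> f q = F (val q)].

(* x |-> f (x / |x|), the extension of f to R^3 \ {0} constant along rays
   (with value 0 at the origin). *)
Definition radial_ext (f : sphere -> R) (x : 'rV[R]_3) : R :=
  oapp f 0 (insub ((Num.sqrt (sqnorm x))^-1 *: x) : option sphere).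

(* The differential of f at p is the restriction to T_p S^2 of the covector
   \sum_i (dpart i f p) dx_i; any other extension of f would change this
   covector by a multiple of the conormal \sum_i p_i dx_i. *)
Definition dpart (i : 'I_3) (f : sphere -> R) (p : sphere) : R :=
  'D_(delta_mx 0 i) (radial_ext f) (val p).

(* Fields A of contravariant k-tensors of R^3 along S^2, by components:
   A p I = A_p(dx_{I_0}, ..., dx_{I_(k-1)}). *)
Definition tfield (k : nat) : Type := sphere -> k.-tuple 'I_3 -> R.

(* The space X^k(S^2) of smooth sections of \Lambda^k T S^2.  The last
   condition says that A_p vanishes as soon as one of its arguments is the
   conormal covector \sum_i p_i dx_i, i.e. that the alternating tensor A_p lies
   in \Lambda^k(T_p S^2), a subspace of \Lambda^k(R^3). *)
Definition mvfield (k : nat) : set (tfield k) :=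
  [set A | [/\ forall I, smooth (fun p => A p I),
    forall p I (s : 'S_k),
      A p [tuple tnth I (s j) | j < k] = (-1) ^+ s * A p I &
    forall p (I : k.-tuple 'I_3) (j : 'I_k),
      \sum_(i < 3)
        xcoord i p * A p [tuple if l == j then i else tnth I l | l < k] = 0]].

(* A(df_0, ..., df_(k-1)) for fs = [:: f_0; ...; f_(k-1)]. *)
Definition mvapp (k : nat) (A : tfield k) (fs : seq (sphere -> R))
    (p : sphere) : R :=
  \sum_(I : k.-tuple 'I_3)
    A p I * \prod_(j < k) dpart (tnth I j) (nth 0 fs j) p.

(* For fs = [:: f_1; ...; f_n], n = a + b - 1, the sum over the shuffles s
   with s(1) < ... < s(b) and s(b+1) < ... < s(n) of
     sgn(s) A(B(f_s(1), ..., f_s(b)), f_s(b+1), ..., f_s(n)),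
   written as a sum over all permutations, in which each term of the previous
   sum occurs b! (a-1)! times.  It is 0 if A is a function (a = 0). *)
Definition insertion (a b : nat) (A : tfield a) (B : tfield b)
    (fs : seq (sphere -> R)) (p : sphere) : R :=
  if a == 0%N then 0 else
  (\sum_(s : 'S_((a + b).-1))
     let gs := [seq nth 0 fs (s j) | j <- enum 'I_((a + b).-1)] in
     (-1) ^+ s * mvapp A (mvapp B (take b gs) :: drop b gs) p)
  / (b`! * a.-1`!)%N%:R.

(* The Schouten bracket
     [A, B] = A o B - (-1)^((a-1)(b-1)) B o A,   o = insertion,
   with components obtained by evaluation on coordinate functions.  The
   exponent (a+1)(b+1) has the right parity also when a = 0 or b = 0. *)
Definition schouten (a b : nat) (A : tfield a) (B : tfield b) :
    tfield (a + b).-1 :=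
  fun p I =>
    let fs := [seq xcoord i | i <- I] in
    insertion A B fs p - (-1) ^+ (a.+1 * b.+1)%N * insertion B A fs p.

Definition dPoisson (P : tfield 2) (k : nat) (A : tfield k) : tfield k.+1 :=
  schouten P A.

Definition cocycle (P : tfield 2) (k : nat) : set (tfield k) :=
  [set A | mvfield A /\ dPoisson P A = 0].

Definition coboundary (P : tfield 2) (k : nat) : set (tfield k) :=
  match k with
  | 0 => [set 0]
  | k'.+1 => [set dPoisson P A | A in @mvfield k']
  end.

(* The class of A, as a coset of the coboundaries in the cocycles. *)
Definition coh_class (P : tfield 2) (k : nat) (A : tfield k) :
    set (tfield k) :=
  [set B | cocycle P B /\ coboundary P (B - A)].

Definition poisson_cohomology (P : tfield 2) (k : nat) :
    set (set (tfield k)) :=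
  [set coh_class P A | A in @cocycle P k].

(* The components of \partial_i /\ \partial_j. *)
Definition wedge (i j : 'I_3) (I : 2.-tuple 'I_3) : R :=
  (I == [tuple i; j])%:R - (I == [tuple j; i])%:R.

(* x_1, x_2, x_3 are [xcoord 0], [xcoord 1], [xcoord 2]. *)
Definition pi_std : tfield 2 := fun p I =>
  - (xcoord 0 p * wedge 1 2 I + xcoord 1 p * wedge 2 0 I
     + xcoord 2 p * wedge 0 1 I).

Definition pi_c (c : R) : tfield 2 := fun p I =>
  (c - xcoord 2 p) * pi_std p I.

End Sphere.

(* Main.v *)
Require Import Defs.
From HB Require Import structures.
From mathcomp Require Import all_boot all_order all_fingroup all_algebra.
From mathcomp Require Import all_classical all_reals all_analysis.
From mathcomp Require Import ring.

Set Implicit Arguments.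
Unset Strict Implicit.
Unset Printing Implicit Defensive.

Import Order.TTheory GRing.Theory Num.Theory.
Import numFieldNormedType.Exports.

Local Open Scope classical_set_scope.
Local Open Scope ring_scope.

(** A vector field X with [pi_c, X] = pi satisfies, away from the poles,
    f (da/dt + db/dtheta) + a = 1 on the sphere, where t = x_3, theta is the
    longitude, f = c - t, and a, b are the components of X along d/dt and
    d/dtheta.  Averaging over theta kills the b-term, so the mean h(t) of a
    solves f h' + h = 1, i.e. (h - 1)/f is constant on each side of t = c.
    Since X is tangent to the sphere, h vanishes at both poles t = -1, 1, and
    this forces the two constants to have opposite signs; then h cannot be
    differentiable at t = c.  We use the colatitude u, with t = cos u, because
    all functions involved are then smooth on the whole real line. *)

(** * Functions on the sphere *)

Section SphereFunctions.
Variable R : realType.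

Lemma is_derive_comp_rV n (F : 'rV[R]_n -> R) (g : R -> 'rV[R]_n)
    (dg : 'I_n -> R) (s : R) :
  differentiable F (g s) ->
  (forall i, is_derive s 1 (fun t => g t 0 i) (dg i)) ->
  is_derive s 1 (F \o g) (\sum_i dg i * 'D_(delta_mx 0 i) F (g s)).
Proof.
move=> dF dgE.
have derg : derivable g s 1.
  by apply/derivable_mxP => i j; rewrite ord1; apply: ex_derive.
have difg : differentiable g s by apply/derivable1_diffP.
have difFg : differentiable (F \o g) s by apply: differentiable_comp.
apply: DeriveDef; first exact: diff_derivable.
have gE : 'd g s 1 = \sum_i dg i *: delta_mx 0 i.
  rewrite -deriveE// derive_mx// [LHS]row_sum_delta.
  by apply: eq_bigr => i _; rewrite mxE (@derive_val _ _ _ _ _ _ _ (dgE i)).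
rewrite deriveE// diff_comp//= gE linear_sum; apply: eq_bigr => i _.
by rewrite linearZ /= deriveE.
Qed.

Lemma sqnorm_sphere (p : sphere R) : sqnorm (val p) = 1.
Proof. exact/eqP/(valP p). Qed.

Lemma sqnorm_line (p : sphere R) i (s : R) :
  sqnorm (s *: delta_mx 0 i + val p) = 1 + s * xcoord i p *+ 2 + s ^+ 2.
Proof.
transitivity (sqnorm (val p) + s * xcoord i p *+ 2 + s ^+ 2);
  last by rewrite sqnorm_sphere.
rewrite /sqnorm /xcoord.
under eq_bigr do rewrite !mxE eqxx /= sqrrD.
rewrite !big_split /=.
have -> : \sum_(j < 3) (s * (j == i)%:R) ^+ 2 = s ^+ 2.
  rewrite (bigD1 i)//= big1 => [|j ji];
    last by rewrite (negbTE ji) mulr0 expr0n.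
  by rewrite eqxx mulr1 addr0.
have -> : \sum_(j < 3) s * (j == i)%:R * val p 0 j = s * val p 0 i.
  rewrite (bigD1 i)//= big1 => [|j ji]; last by rewrite (negbTE ji) mulr0 mul0r.
  by rewrite eqxx mulr1 addr0.
ring.
Qed.

Lemma radial_extE (f : sphere R -> R) (F : 'rV[R]_3 -> R) (U : set 'rV[R]_3) x :
  0 < sqnorm x -> U ((Num.sqrt (sqnorm x))^-1 *: x) ->
  (forall q : sphere R, U (val q) -> f q = F (val q)) ->
  radial_ext f x = F ((Num.sqrt (sqnorm x))^-1 *: x).
Proof.
move=> x0 Ux fF; rewrite /radial_ext.
have H : sqnorm ((Num.sqrt (sqnorm x))^-1 *: x) == 1.
  rewrite {1}/sqnorm; under eq_bigr do rewrite mxE exprMn.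
  by rewrite -mulr_sumr exprVn sqr_sqrtr ?ltW// mulVf// gt_eqF.
by rewrite insubT /= fF.
Qed.

(** Along the line [p + s e_i] the radial extension takes the value of [F] at the normalised point
    [g s]. The velocity of [g] at 0 is [e_i - p_i p], the projection of [e_i] to the tangent plane,
    so [dpart] gives the tangential part of the gradient of [F]. *)
Lemma dpartE (f : sphere R -> R) (F : 'rV[R]_3 -> R) (U : set 'rV[R]_3)
    (p : sphere R) i :
  open U -> U (val p) -> differentiable F (val p) ->
  (forall q : sphere R, U (val q) -> f q = F (val q)) ->
  dpart i f p = \sum_j ((i == j)%:R - xcoord i p * xcoord j p) *
                  'D_(delta_mx 0 j) F (val p).
Proof.
move=> oU Up dF fF.
pose n2 s := 1 + s * xcoord i p *+ 2 + s ^+ 2.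
pose g s : 'rV[R]_3 := (Num.sqrt (n2 s))^-1 *: (s *: delta_mx 0 i + val p).
have n20 : n2 0 = 1 by rewrite /n2 mul0r mul0rn expr0n !addr0.
have g0 : g 0 = val p by rewrite /g n20 sqrtr1 invr1 scale1r scale0r add0r.
have dn2 : is_derive (0 : R) 1 n2 (xcoord i p *+ 2).
  by rewrite /n2; apply: is_derive_eq; rewrite /GRing.scale /=; ring.
have dgi j : is_derive (0 : R) 1 (fun s => g s 0 j)
    ((i == j)%:R - xcoord i p * xcoord j p).
  have -> : (fun s => g s 0 j) =
      (fun s => (Num.sqrt (n2 s))^-1 * (s * (i == j)%:R + xcoord j p)).
    by apply/funext => s; rewrite /g !mxE eqxx eq_sym.
  have ds : is_derive (0 : R) 1 (Num.sqrt \o n2) (xcoord i p).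
    have sd : is_derive (n2 0) 1 Num.sqrt (2 * Num.sqrt (n2 0))^-1.
      by apply: is_derive1_sqrt; rewrite n20.
    apply: is_derive_eq.
    by rewrite n20 sqrtr1; field.
  have n0 : (Num.sqrt \o n2) 0 != 0 by rewrite /= n20 sqrtr1 oner_eq0.
  have dl : is_derive (0 : R) 1
      (fun s : R => s * (i == j)%:R + xcoord j p) (i == j)%:R.
    by apply: is_derive_eq; rewrite /GRing.scale /=; ring.
  apply: (is_derive_eq (is_deriveM (is_deriveV n0 ds) dl)).
  by rewrite /GRing.scale /= n20 sqrtr1 expr1n invr1; ring.
have cg : {for 0, continuous g}.
  apply: differentiable_continuous; apply/derivable1_diffP/derivable_mxP => k j.
  by rewrite ord1; apply: ex_derive.
have := is_derive_comp_rV _ dgi; rewrite g0 => /(_ F dF) dFg.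
rewrite -(@derive_val _ _ _ _ _ _ _ dFg).
(* The directional derivative at [val p] becomes a derivative at 0 in one real variable, to be
   compared with [F \o g] near 0. *)
transitivity ('D_1 (fun s : R => radial_ext f (s *: delta_mx 0 i + val p)) 0).
  rewrite /dpart /derive /=.
  by under [in RHS]eq_fun do rewrite scaler1 addr0 scale0r add0r.
apply: near_eq_derive => //.
have n2c : {for 0, continuous n2}.
  by apply: differentiable_continuous; apply/derivable1_diffP; apply: ex_derive.
near=> s => /=.
rewrite (@radial_extE f F U) ?sqnorm_line//.
- near: s; apply: (cvgr_gt (n2 0)) => //; by rewrite n20.
- near: s; apply: cg; rewrite g0; exact: open_nbhs_nbhs.
Unshelve. all: by end_near. Qed.

(** The lists [[::]] and [[:: v]] in [smooth_on] give these two orders of differentiability; the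
    second makes the first derivatives continuous. *)
Lemma smooth_local (f : sphere R -> R) (p : sphere R) : smooth f ->
  exists (U : set 'rV[R]_3) (F : 'rV[R]_3 -> R), [/\ open U, U (val p),
    forall q : sphere R, U (val q) -> f q = F (val q),
    forall x, U x -> differentiable F x &
    forall v x, U x -> differentiable ('D_v F) x].
Proof.
move=> /(_ p)[U [F [oU Up sF fF]]]; exists U, F; split => //.
- by move=> x Ux; exact: (sF [::]).
- by move=> v x Ux; exact: (sF [:: v]).
Qed.

Lemma continuous_rV (T : topologicalType) n (g : T -> 'rV[R]_n) t :
  (forall i, {for t, continuous (fun u => g u 0 i)}) -> {for t, continuous g}.
Proof.
move=> cg; apply/cvgrPdist_lt => e e0; near=> u.
rewrite [ltLHS]/Num.Def.normr /= mx_normrE.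
apply: (big_ind (fun x => x < e)) => // [x y xe ye|[k i] _ /=].
  by rewrite gt_max xe.
rewrite ord1 !mxE; move: i; near: u.
by apply: filter_forall => i; exact: (cvgrPdist_lt _ _).1 (cg i) _ e0.
Unshelve. all: by end_near. Qed.

Lemma continuous_sphere (T : topologicalType) (g : T -> sphere R) t :
  (forall i, {for t, continuous (fun u => xcoord i (g u))}) ->
  {for t, continuous (fun u => val (g u))}.
Proof. by move=> cg; apply: continuous_rV. Qed.

(** Near each point the formula of [dpartE] holds with one fixed local extension [F], and all its
    terms are continuous. *)
Lemma dpart_continuous (T : topologicalType) (f : sphere R -> R) i
    (g : T -> sphere R) : smooth f ->
  (forall j, continuous (fun u => xcoord j (g u))) ->
  continuous (fun u => dpart i f (g u)).
Proof.
move=> sf cg t; have [U [F [oU Ut fF dF ddF]]] := smooth_local (g t) sf.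
have cval : {for t, continuous (fun u => val (g u))}.
  by apply: continuous_sphere => j; exact: cg.
have nU : \forall u \near t, U (val (g u)).
  by apply: cval; exact: open_nbhs_nbhs.
have E :
    {near t, (fun u => \sum_j ((i == j)%:R - xcoord i (g u) * xcoord j (g u)) *
    'D_(delta_mx 0 j) F (val (g u))) =1 (fun u => dpart i f (g u))}.
  by apply: filterS nU => u Uu; rewrite (dpartE i oU Uu (dF _ Uu) fF).
rewrite /continuous_at (dpartE i oU Ut (dF _ Ut) fF).
apply: cvg_trans (near_eq_cvg E) _.
apply: cvg_big => [|j _]; first exact: add_continuous.
apply: cvgM.
  by apply: cvgB; [exact: cvg_cst|apply: cvgM; exact: cg].
apply: (@cvg_comp _ _ _ (fun u => val (g u)) ('D_(delta_mx 0 j) F));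
  first exact: cval.
exact: differentiable_continuous (ddF _ _ Ut).
Qed.

Lemma sum_ord3 (V : nmodType) (F : 'I_3 -> V) : \sum_i F i = F 0 + F 1 + F 2.
Proof.
rewrite !big_ord_recl big_ord0 addr0 addrA; congr (_ + _ + _); congr F;
  exact: val_inj.
Qed.

Lemma sum_xcoord2 (p : sphere R) : \sum_i xcoord i p ^+ 2 = 1.
Proof. exact: sqnorm_sphere. Qed.

(** The vector of all [dpart i f] differs from the gradient of a local extension by a multiple of
    the position vector, to which the velocity of a curve on the sphere is orthogonal. *)
Lemma is_derive_sphere (f : sphere R -> R) (g : R -> sphere R)
    (dg : 'I_3 -> R) (s : R) : smooth f ->
  (forall i, is_derive s 1 (fun t => xcoord i (g t)) (dg i)) ->
  is_derive s 1 (f \o g) (\sum_i dg i * dpart i f (g s)).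
Proof.
move=> sf dgE; have [U [F [oU Us fF dF ddF]]] := smooth_local (g s) sf.
have cval : {for s, continuous (fun u => val (g u))}.
  apply: continuous_sphere => j.
  by apply: differentiable_continuous; apply/derivable1_diffP; have [] := dgE j.
have nU : \forall u \near s, U (val (g u)).
  by apply: cval; exact: open_nbhs_nbhs.
(* Differentiating [|g t|^2 = 1] shows that the velocity is tangent. *)
have tg : \sum_i dg i * xcoord i (g s) = 0.
  have H : is_derive s 1 (fun t => xcoord 0 (g t) * xcoord 0 (g t) +
      xcoord 1 (g t) * xcoord 1 (g t) + xcoord 2 (g t) * xcoord 2 (g t))
      ((\sum_i dg i * xcoord i (g s)) * 2).
    apply: (is_derive_eq (is_deriveD (is_deriveD (is_deriveM (dgE 0) (dgE 0))
      (is_deriveM (dgE 1) (dgE 1))) (is_deriveM (dgE 2) (dgE 2)))).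
    by rewrite sum_ord3 /GRing.scale /=; ring.
  have E : (fun t => xcoord 0 (g t) * xcoord 0 (g t) +
      xcoord 1 (g t) * xcoord 1 (g t) + xcoord 2 (g t) * xcoord 2 (g t))
        = cst 1.
    by apply/funext => t /=; rewrite -(sum_xcoord2 (g t)) sum_ord3 !expr2.
  move: H; rewrite E => H.
  have := @derive_val _ _ _ _ _ _ _ H; rewrite derive_cst => /esym/eqP.
  by rewrite mulf_eq0 pnatr_eq0 orbF => /eqP.
have H : is_derive s 1 (F \o (fun t => val (g t)))
    (\sum_i dg i * 'D_(delta_mx 0 i) F (val (g s))).
  by apply: is_derive_comp_rV dgE; exact: dF.
have -> : \sum_i dg i * dpart i f (g s) =
    \sum_i dg i * 'D_(delta_mx 0 i) F (val (g s)).
  under eq_bigr do rewrite (dpartE _ oU Us (dF _ Us) fF).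
  move: tg; rewrite !sum_ord3 /=; set a := dg 0; set b := dg 1; set c := dg 2.
  set D0 := 'D__ F _; set D1 := 'D__ F _; set D2 := 'D__ F _.
  move=> tg.
  transitivity (a * D0 + b * D1 + c * D2 - (a * xcoord 0 (g s) + b * xcoord 1
    (g s) + c * xcoord 2 (g s)) * (xcoord 0 (g s) * D0 + xcoord 1 (g s) * D1
    + xcoord 2 (g s) * D2)); last by rewrite tg mul0r subr0.
  ring.
apply: near_eq_is_derive H => //.
by apply: filterS nU => u Uu; rewrite /= fF.
Qed.

(** The coordinates, the components of [pi_std] and the factor [c - x_3] are restrictions of such
    functions, so smoothness and [dpart] are settled for all of them at once. *)
Definition affine (a : R) (b : 'I_3 -> R) (x : 'rV[R]_3) : R :=
  a + \sum_j b j * x 0 j.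

Lemma differentiable_affine a b (x : 'rV[R]_3) : differentiable (affine a b) x.
Proof.
apply: differentiableD; first exact: differentiable_cst.
rewrite (_ : (fun _ => _) = \sum_(j < 3) (fun x : 'rV[R]_3 => b j *: x 0 j)).
  by apply: differentiable_sum => j; apply: differentiableZ;
    exact: differentiable_coord.
by apply/funext => y; rewrite fct_sumE.
Qed.

Lemma derive_affine a b v (x : 'rV[R]_3) : 'D_v (affine a b) x =
  \sum_j b j * v 0 j.
Proof.
have E : (fun h : R => affine a b (h *: v + x)) =
    (fun h => affine a b x + h * \sum_j b j * v 0 j).
  apply/funext => h; rewrite /affine mulr_sumr -addrA -big_split /=;
    congr (_ + _).
  by apply: eq_bigr => j _; rewrite !mxE; ring.
have H : is_derive (0 : R) 1
    (fun h => affine a b x + h * \sum_j b j * v 0 j) (\sum_j b j * v 0 j).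
  by apply: is_derive_eq; rewrite /GRing.scale /=; ring.
rewrite -[RHS](@derive_val _ _ _ _ _ _ _ H) -E /derive /=.
by under [in RHS]eq_fun do rewrite scaler1 addr0 scale0r add0r.
Qed.

Lemma smooth_on_affine a b : smooth_on setT (affine a b).
Proof.
move=> vs x _.
suff [->|[k ->]] : foldr (fun v G => 'D_v G) (affine a b) vs = affine a b \/
    exists k, foldr (fun v G => 'D_v G) (affine a b) vs = cst k.
- exact: differentiable_affine.
- exact: differentiable_cst.
elim: vs => [|v vs IH] /=; first by left.
right; case: IH => [->|[k ->]].
- by exists (\sum_j b j * v 0 j); apply/funext => y; rewrite derive_affine.
- by exists 0; apply/funext => y; rewrite derive_cst.
Qed.

Lemma smooth_affine a b : smooth (fun p : sphere R => affine a b (val p)).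
Proof. by move=> p; exists setT, (affine a b); split=> //;
  [exact: openT|exact: smooth_on_affine]. Qed.

Lemma dpart_affine i a b (p : sphere R) :
  dpart i (fun p => affine a b (val p)) p =
  b i - xcoord i p * \sum_j b j * xcoord j p.
Proof.
rewrite (@dpartE _ (affine a b) setT p i)//;
  [|exact: openT|exact: differentiable_affine].
have De j : 'D_(delta_mx 0 j) (affine a b) (val p) = b j.
  rewrite derive_affine (bigD1 j)//= big1 => [|k /negbTE kj].
    by rewrite addr0 mxE !eqxx mulr1.
  by rewrite mxE kj andbF mulr0.
under eq_bigr do rewrite De mulrBl.
rewrite big_split /= (bigD1 i)//= big1 => [|j /negbTE ji].
  rewrite eqxx mul1r addr0; congr (_ + _); rewrite sumrN mulr_sumr; congr (- _).
  by apply: eq_bigr => j _; ring.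
by rewrite eq_sym ji mul0r.
Qed.

Lemma dpartM i (f g : sphere R -> R) p : smooth f -> smooth g ->
  dpart i (fun q => f q * g q) p = f p * dpart i g p + g p * dpart i f p.
Proof.
move=> sf sg; have [U [F [oU Up fF dF _]]] := smooth_local p sf.
have [V [G [oV Vp gG dG _]]] := smooth_local p sg.
rewrite (@dpartE _ (F * G) (U `&` V) p i); last 4 first.
- exact: openI.
- by split.
- by apply: differentiableM; [exact: dF|exact: dG].
- by move=> q [Uq Vq]; rewrite fF// gG.
rewrite (dpartE i oU Up (dF _ Up) fF) (dpartE i oV Vp (dG _ Vp) gG).
rewrite fF// gG// !mulr_sumr -big_split /=; apply: eq_bigr => j _.
rewrite deriveM; [|exact/diff_derivable/dF|exact/diff_derivable/dG].
by rewrite /GRing.scale /=; ring.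
Qed.

End SphereFunctions.

(** * Brackets of multivector fields *)

Section Perms.

(** By counting. This lets the sums over permutations in [insertion] run over explicit lists. *)
Lemma perm_seq_mem (n : nat) (l : seq 'S_n) s :
  uniq l -> size l = n`! -> s \in l.
Proof.
move=> ul sl.
have [||_ E] := uniq_min_size ul (s2 := index_enum ('S_n : finType)).
- by move=> t _; rewrite mem_index_enum.
- rewrite sl -(card_Sn n) cardT enumT [index_enum _]unlock; exact: leqnn.
- by rewrite E mem_index_enum.
Qed.

Lemma big_perm_seq (n : nat) (V : nmodType) (F : 'S_n -> V) (l : seq 'S_n) :
  uniq l -> size l = n`! -> \sum_s F s = \sum_(s <- l) F s.
Proof.
move=> ul sl; apply: perm_big; apply: uniq_perm => //;
  first exact: index_enum_uniq.
by move=> t; rewrite mem_index_enum perm_seq_mem.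
Qed.

Lemma sum_S2 (V : nmodType) (F : 'S_2 -> V) : \sum_s F s = F 1%g + F
  (tperm 0 1).
Proof.
rewrite (@big_perm_seq 2 V F [:: 1%g; tperm 0 1]) ?big_cons ?big_nil ?addr0//=.
rewrite inE andbT; apply/eqP => /permP/(_ 0); rewrite perm1 tpermL => /eqP //.
Qed.

Lemma sum_S3 (V : nmodType) (F : 'S_3 -> V) :
  \sum_s F s = F 1%g + F (tperm 0 1) + F (tperm 1 2) + F (tperm 0 2)
     + F (tperm 0%R 1%R * tperm 0%R 2%R)%g + F
       (tperm 0%R 2%R * tperm 0%R 1%R)%g.
Proof.
rewrite (@big_perm_seq 3 V F [:: 1%g; tperm 0 1; tperm 1 2; tperm 0 2;
   (tperm 0%R 1%R * tperm 0%R 2%R)%g;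
     (tperm 0%R 2%R * tperm 0%R 1%R)%g]) ?big_cons ?big_nil ?addr0 ?addrA//.
(* The six permutations are told apart by their values at 0 and 1. *)
apply: (@map_uniq _ _ (fun s : 'S_3 => (s 0, s 1))) => /=.
by rewrite !permM !perm1 !permE.
Qed.
End Perms.

(** * Insertions in the degrees that occur *)

Section Expansions.
Variable R : realType.

Lemma sum_tuple1 (V : nmodType) (F : 1.-tuple 'I_3 -> V) :
  \sum_I F I = \sum_i F [tuple i].
Proof.
rewrite (reindex (fun i : 'I_3 => [tuple i])) //.
exists (fun I : 1.-tuple 'I_3 => tnth I 0) => [i _|I _] //.
by apply/val_inj; case: I => -[|a [|]] //=.
Qed.

Lemma sum_tuple2 (V : nmodType) (F : 2.-tuple 'I_3 -> V) :
  \sum_I F I = \sum_i \sum_j F [tuple i; j].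
Proof.
rewrite pair_big /= (reindex (fun i : 'I_3 * 'I_3 => [tuple i.1; i.2])) //.
exists (fun I : 2.-tuple 'I_3 => (tnth I 0, tnth I 1)) => [[i j] _|I _] //.
by apply/val_inj; case: I => -[|a [|b [|]]] //=.
Qed.

Lemma mvapp1E (A : tfield R 1) f p :
  mvapp A [:: f] p = \sum_i A p [tuple i] * dpart i f p.
Proof.
by rewrite /mvapp sum_tuple1; apply: eq_bigr => i _; rewrite big_ord1.
Qed.

Lemma mvapp2E (A : tfield R 2) f g p :
  mvapp A [:: f; g] p =
  \sum_i \sum_j A p [tuple i; j] * (dpart i f p * dpart j g p).
Proof.
rewrite /mvapp sum_tuple2; apply: eq_bigr => i _; apply: eq_bigr => j _.
by rewrite !big_ord_recl big_ord0 mulr1.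
Qed.

Lemma insertion21 (P : tfield R 2) (X : tfield R 1) f g p :
  insertion P X [:: f; g] p =
  mvapp P [:: mvapp X [:: f]; g] p - mvapp P [:: mvapp X [:: g]; f] p.
Proof.
rewrite /insertion /= !factS fact0 !muln1 invr1 mulr1.
have -> : enum 'I_2 = [:: 0; 1] by apply: (inj_map val_inj);
  rewrite val_enum_ord.
by rewrite sum_S2 /= odd_perm1 odd_tperm /= expr0 expr1 mul1r mulN1r !permE.
Qed.

Lemma insertion12 (P : tfield R 2) (X : tfield R 1) f g p :
  insertion X P [:: f; g] p =
  (mvapp X [:: mvapp P [:: f; g]] p - mvapp X [:: mvapp P [:: g; f]] p) / 2.
Proof.
rewrite /insertion /= !factS fact0 !muln1.
have -> : enum 'I_2 = [:: 0; 1] by apply: (inj_map val_inj);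
  rewrite val_enum_ord.
by rewrite sum_S2 /= odd_perm1 odd_tperm /= expr0 expr1 mul1r mulN1r !permE.
Qed.

(** The cyclic orders of [f, g, h] carry a plus sign, the others a minus sign; 2 is [b! (a-1)!] for
    [a = b = 2]. *)
Lemma insertion22 (P Q : tfield R 2) f g h p :
  let G a b c := mvapp P [:: mvapp Q [:: a; b]; c] p in
  insertion P Q [:: f; g; h] p =
  (G f g h - G g f h + G g h f - G h g f + G h f g - G f h g) / 2.
Proof.
move=> G; rewrite /insertion /= !factS fact0 !muln1.
have -> : enum 'I_3 = [:: 0; 1; 2] by apply: (inj_map val_inj);
  rewrite val_enum_ord.
rewrite sum_S3 /= !odd_permM odd_perm1 !odd_tperm /= expr0 expr1 !mul1r !mulN1r.
rewrite !permM !permE /= -!/(G _ _ _). 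
move: (G f g h) (G g f h) (G f h g) (G h g f) (G g h f) (G h f g) =>
  x1 x2 x3 x4 x5 x6.
by congr (_ / _); ring.
Qed.
End Expansions.

(** * The bivector fields as determinants, and the cocycle condition *)

Section Bivectors.
Variable R : realType.
Implicit Types (p : sphere R) (i j k : 'I_3) (c : R).

Definition basis_coord (k i : 'I_3) : R := (i == k)%:R.
Local Notation e := basis_coord.

Lemma wedgeE a b i j : wedge R a b [tuple i; j] = e a i * e b j - e b i * e a j.
Proof. by rewrite /wedge /e -!natrM !mulnb -!val_eqE /= !eqseq_cons !andbT. Qed.

(** The constant gradient in R^3 of the linear form that gives the component [I] of [pi_std]. *)
Definition pi_coef (I : 2.-tuple 'I_3) k : R :=
  - (e 0 k * wedge R 1 2 I + e 1 k * wedge R 2 0 I + e 2 k * wedge R 0 1 I).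

Lemma pi_affine I : pi_std (R := R) ^~ I =
    (fun p => affine 0 (pi_coef I) (val p)).
Proof.
apply/funext => p; rewrite /pi_std /affine sum_ord3 /pi_coef /e /= /xcoord;
  ring.
Qed.

Lemma xcoord_affine i : @xcoord R i = (fun p => affine 0 (e ^~ i) (val p)).
Proof.
apply/funext => p; rewrite /affine (bigD1 i)//= big1 => [|j /negbTE ji].
  by rewrite /e eqxx mul1r addr0 add0r.
by rewrite /e eq_sym ji mul0r.
Qed.

Lemma height_affine c : (fun p => c - xcoord 2 p) =
    (fun p => affine c (fun k => - e k 2) (val p)).
Proof.
by apply/funext => p; rewrite /affine sum_ord3 /e /= /xcoord; ring.
Qed.

Lemma smooth_pi_std I : smooth (pi_std (R := R) ^~ I).
Proof. rewrite pi_affine; exact: smooth_affine. Qed.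

Lemma dpart_xcoord i j p : dpart i (xcoord j) p
  = e i j - xcoord i p * xcoord j p.
Proof. 
rewrite {1}xcoord_affine dpart_affine
  [in RHS](xcoord_affine j) /affine add0r //.
Qed.

Lemma dpart_pi_std k I p :
  dpart k (pi_std (R := R) ^~ I) p = pi_coef I k - xcoord k p * pi_std p I.
Proof.
rewrite pi_affine dpart_affine -[pi_std p I]/((pi_std (R
  := R) ^~ I) p) pi_affine.
by rewrite /affine add0r.
Qed.

Lemma dpart_height c k p :
  dpart k (fun q => c - xcoord 2 q) p = - (e k 2 - xcoord k p * xcoord 2 p).
Proof. by rewrite height_affine dpart_affine sum_ord3 /e /=; ring. Qed.

Lemma dpart_pi_c c k I p : dpart k (pi_c c ^~ I) p =
  (c - xcoord 2 p) * (pi_coef I k - xcoord k p * pi_std p I)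
  - pi_std p I * (e k 2 - xcoord k p * xcoord 2 p).
Proof.
rewrite /pi_c dpartM; last 2 first.
- rewrite height_affine; exact: smooth_affine.
- exact: smooth_pi_std.
by rewrite dpart_pi_std dpart_height [X in _ + X = _]mulrN.
Qed.

Lemma basis_coord3 : [/\ e 0 0 = 1, e 1 1 = 1, e 2 2 = 1 &
  [/\ e 0 1 = 0, e 0 2 = 0 & [/\ e 1 0 = 0, e 1 2 = 0, e 2 0 = 0 & e 2 1 = 0]]].
Proof. by []. Qed.

Lemma sum_basis_coord2 (f g : 'I_3 -> R) a b :
  \sum_i \sum_j (e a i * e b j) * (f i * g j) = f a * g b.
Proof.
rewrite (bigD1 a)//= [X in _ + X]big1 => [|i /negbTE ia].
  rewrite addr0 (bigD1 b)//= [X in _ + X]big1 => [|j /negbTE jb].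
    by rewrite /e !eqxx !mul1r addr0.
  by rewrite /e jb mulr0 mul0r.
by rewrite big1// => j _; rewrite /e ia !mul0r.
Qed.

(** The determinant with rows [x], [f], [g]. Up to sign, [pi_std] is this form with the position
    vector as first row. *)
Definition det3 (x f g : 'I_3 -> R) : R :=
  x 0 * (f 1 * g 2 - f 2 * g 1) + x 1 * (f 2 * g 0 - f 0 * g 2)
  + x 2 * (f 0 * g 1 - f 1 * g 0).

(** Bilinearity in the last two rows; it turns the sum over components in [mvapp] into one
    determinant. *)
Lemma sum_det3_basis (x f g : 'I_3 -> R) :
  \sum_i \sum_j det3 x (e ^~ i) (e ^~ j) * (f i * g j) = det3 x f g.
Proof.
have E i j : det3 x (e ^~ i) (e ^~ j) * (f i * g j) =
  x 0 * ((e 1 i * e 2 j) * (f i * g j) - (e 2 i * e 1 j) * (f i * g j)) +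
  x 1 * ((e 2 i * e 0 j) * (f i * g j) - (e 0 i * e 2 j) * (f i * g j)) +
  x 2 * ((e 0 i * e 1 j) * (f i * g j) - (e 1 i * e 0 j) * (f i * g j)).
  by rewrite /det3; ring.
under eq_bigr do under eq_bigr do rewrite E.
under eq_bigr do rewrite !big_split /= -!mulr_sumr !sumrB.
by rewrite !big_split /= -!mulr_sumr !sumrB !sum_basis_coord2.
Qed.

Lemma pi_stdE p i j :
  pi_std p [tuple i; j] = - det3 (fun l => xcoord l p) (e ^~ i) (e ^~ j).
Proof. by rewrite /pi_std !wedgeE. Qed.

Lemma mvapp_pi_std f g p :
  mvapp (@pi_std R) [:: f; g] p =
  - det3 (fun l => xcoord l p) (fun l => dpart l f p) (fun l => dpart l g p).
Proof.
rewrite mvapp2E -sum_det3_basis -sumrN; apply: eq_bigr => i _.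
by rewrite -sumrN; apply: eq_bigr => j _; rewrite pi_stdE mulNr.
Qed.

Lemma mvapp_pi_c c f g p :
  mvapp (pi_c c) [:: f; g] p = (c - xcoord 2 p) * mvapp (@pi_std R) [:: f; g] p.
Proof.
rewrite !mvapp2E mulr_sumr; apply: eq_bigr => i _; rewrite mulr_sumr.
by apply: eq_bigr => j _; rewrite /pi_c -mulrA.
Qed.

(** Multiples of the first row may be added to the other rows. The radial terms in [dpart] thus drop
    out of every bracket. *)
Lemma det3_shift (x f g : 'I_3 -> R) m n :
  det3 x (fun l => f l - x l * m) (fun l => g l - x l * n) = det3 x f g.
Proof. by rewrite /det3; ring. Qed.

Lemma mvapp_pi_std_xcoord i j :
  mvapp (@pi_std R) [:: xcoord i; xcoord j] = (@pi_std R)^~ [tuple i; j].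
Proof.
apply/funext => p; rewrite mvapp_pi_std pi_stdE -(det3_shift _ (e ^~ i)
  (e ^~ j) (xcoord i p) (xcoord j p)).
by congr (- det3 _ _ _); apply/funext => l; rewrite dpart_xcoord.
Qed.

Lemma mvapp_pi_c_xcoord c i j :
  mvapp (@pi_c R c) [:: xcoord i; xcoord j] = (@pi_c R c)^~ [tuple i; j].
Proof.
by apply/funext => p; rewrite mvapp_pi_c mvapp_pi_std_xcoord.
Qed.

Lemma map_tuple3 (T : Type) (f : 'I_3 -> T) (I : 3.-tuple 'I_3) :
  [seq f i | i <- I] = [:: f (tnth I 0); f (tnth I 1); f (tnth I 2)].
Proof. by case: I => -[|a [|b [|d [|]]]] //= s; rewrite !(tnth_nth a). Qed.

Lemma tuple2_eta (I : 2.-tuple 'I_3) : I = [tuple tnth I 0; tnth I 1].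
Proof.
by apply/val_inj; case: I => -[|a [|b [|]]] //= s; rewrite !(tnth_nth a).
Qed.

(** The cross product, so that [det3 x f g] is its scalar product with [x]. *)
Definition cross3 (f g : 'I_3 -> R) (k : 'I_3) : R :=
  e 0 k * (f 1 * g 2 - f 2 * g 1) + e 1 k * (f 2 * g 0 - f 0 * g 2)
  + e 2 k * (f 0 * g 1 - f 1 * g 0).

Lemma pi_coefE i j k : pi_coef [tuple i; j] k = - cross3 (e ^~ i) (e ^~ j) k.
Proof. by rewrite /pi_coef !wedgeE. Qed.

Lemma cross3E (f g : 'I_3 -> R) : [/\ cross3 f g 0 = f 1 * g 2 - f 2 * g 1,
  cross3 f g 1 = f 2 * g 0 - f 0 * g 2 & cross3 f g 2 = f 0 * g 1 - f 1 * g 0].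
Proof.
rewrite /cross3; have [-> -> -> [-> -> [-> -> -> ->]]] := basis_coord3.
by rewrite !mul0r !mul1r !addr0 !add0r.
Qed.

(** The bracket of [x_i] and [x_j] is minus the scalar product of [x] with the cross product of
    [e_i] and [e_j], so its differential is minus that cross product up to a radial term; the outer
    bracket brings the second sign. *)
Lemma jacobi_pi i j k p :
  mvapp (@pi_std R) [:: (@pi_std R)^~ [tuple i; j]; xcoord k] p =
  det3 (fun l => xcoord l p) (cross3 (e ^~ i) (e ^~ j)) (e ^~ k).
Proof.
rewrite mvapp_pi_std.
have -> : (fun l => dpart l ((@pi_std R)^~ [tuple i; j]) p) =
    (fun l => - cross3 (e ^~ i) (e ^~ j) l
              - xcoord l p * pi_std p [tuple i; j]).
  by apply/funext => l; rewrite dpart_pi_std pi_coefE.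
have -> : (fun l => dpart l (xcoord k) p) =
    (fun l => e l k - xcoord l p * xcoord k p).
  by apply/funext => l; rewrite dpart_xcoord.
rewrite (det3_shift _ _ (fun l => e l k)) /det3; ring.
Qed.

(** Product rule: the last term comes from the differential of the factor [c - x_3]. The outer
    bracket is that of [pi_std], because [mvapp_pi_c] pulls its factor out. *)
Lemma jacobi_pi_c c i j k p :
  mvapp (@pi_std R) [:: (@pi_c R c)^~ [tuple i; j]; xcoord k] p =
  (c - xcoord 2 p) *
    det3 (fun l => xcoord l p) (cross3 (e ^~ i) (e ^~ j)) (e ^~ k)
  + pi_std p [tuple i; j] * det3 (fun l => xcoord l p) (e ^~ 2) (e ^~ k).
Proof.
rewrite mvapp_pi_std.
have -> : (fun l => dpart l ((@pi_c R c)^~ [tuple i; j]) p) =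
    (fun l => (- (c - xcoord 2 p) * cross3 (e ^~ i) (e ^~ j) l
               - pi_std p [tuple i; j] * e l 2)
       - xcoord l p * (pi_std p [tuple i; j] * (c - xcoord 2 p - xcoord 2 p))).
  by apply/funext => l; rewrite dpart_pi_c pi_coefE; ring.
have -> : (fun l => dpart l (xcoord k) p) =
    (fun l => e l k - xcoord l p * xcoord k p).
  by apply/funext => l; rewrite dpart_xcoord.
rewrite (det3_shift _ _ (fun l => e l k)) /det3; ring.
Qed.

Lemma cross3C (f g : 'I_3 -> R) : cross3 g f = \- cross3 f g.
Proof. by apply/funext => l; rewrite /cross3 /=; ring. Qed.

Lemma det3C (x f g : 'I_3 -> R) : det3 x g f = - det3 x f g.
Proof. by rewrite /det3; ring. Qed.

Lemma det3Nl (x f g : 'I_3 -> R) : det3 x (\- f) g = - det3 x f g.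
Proof. by rewrite /det3 /=; ring. Qed.

(** The Jacobi identity of the cross product, paired with [x]. *)
Lemma cross3_jacobi (x f g h : 'I_3 -> R) :
  det3 x (cross3 f g) h + det3 x (cross3 g h) f + det3 x (cross3 h f) g = 0.
Proof.
rewrite /det3; have [-> -> ->] := cross3E f g; have [-> -> ->] := cross3E g h.
have [-> -> ->] := cross3E h f; ring.
Qed.

(** The 2-form [det3 x] has [x] in its kernel, so its rank is at most 2 and its wedge square
    vanishes. *)
Lemma det3_plucker (x f g h t : 'I_3 -> R) :
  det3 x f g * det3 x t h + det3 x g h * det3 x t f + det3 x h f * det3 x t g
    = 0.
Proof. by rewrite /det3; ring. Qed.

(** Once all brackets are determinants, the terms with the factor [c - x_3] cancel by the Jacobi
    identity of the cross product, and those with the derivative of this factor by the Plucker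
    relation. *)
Lemma dPoisson_pi_c_pi_std c : dPoisson (pi_c c) (@pi_std R) = 0.
Proof.
apply/funext => p; apply/funext => I.
rewrite /dPoisson /schouten (map_tuple3 _ (I : 3.-tuple 'I_3)) /=.
move: (tnth _ _) (tnth _ _) (tnth _ _) => i j k.
rewrite !insertion22 -signr_odd /= expr1 mulN1r opprK.
rewrite !mvapp_pi_std_xcoord !mvapp_pi_c_xcoord !mvapp_pi_c.
rewrite !jacobi_pi !jacobi_pi_c !pi_stdE.
move: (e ^~ i) (e ^~ j) (e ^~ k) (e ^~ 2) (fun l =>
  xcoord l p) (c - xcoord 2 p) => f g h t x d.
rewrite (cross3C f g) (cross3C g h) (cross3C h f) !det3Nl.
rewrite (det3C x f g) (det3C x g h) (det3C x h f).
have := cross3_jacobi x f g h; have := det3_plucker x f g h t.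
move: (det3 x f g) (det3 x g h) (det3 x h f) (det3 x t f) (det3 x t g)
  (det3 x t h) => a1 a2 a3 b1 b2 b3.
move: (det3 x (cross3 f g) h) (det3 x (cross3 g h) f) (det3 x (cross3 h f) g)
  => c1 c2 c3 H1 H2.
rewrite -mulrDl; apply/eqP; rewrite mulf_eq0; apply/orP; left; apply/eqP.
transitivity (- 4 * d * (c1 + c2 + c3) + 2 * (a1 * b3 + a2 * b1 + a3 * b2));
  last first.
  by rewrite H1 H2 !mulr0 addr0.
ring.
Qed.

Lemma sum_det3_radial (x g : 'I_3 -> R) : \sum_i x i * det3 x (e ^~ i) g = 0.
Proof.
rewrite sum_ord3 /det3; have [-> -> -> [-> -> [-> -> -> ->]]] := basis_coord3.
ring.
Qed.

(** Alternation is that of the determinant; inserting the conormal covector repeats the row [x],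
    which gives tangency. *)
Lemma mvfield_pi_std : mvfield (@pi_std R).
Proof.
split.
- exact: smooth_pi_std.
- move=> p I s; rewrite [in RHS](tuple2_eta I).
  have -> : [tuple tnth I (s j) | j < 2] = [tuple tnth I (s 0); tnth I (s 1)].
    by rewrite [LHS]tuple2_eta !tnth_mktuple.
  have : s \in [:: 1%g; tperm 0 1].
    have ul : uniq [:: 1%g; tperm (0 : 'I_2) 1].
      by rewrite /= inE andbT; apply/eqP => /permP/(_ 0);
        rewrite perm1 tpermL => /eqP.
    exact: perm_seq_mem.
  rewrite !inE => /orP[/eqP ->|/eqP ->].
    by rewrite !perm1 odd_perm1 expr0 mul1r.
  by rewrite tpermL tpermR odd_tperm /= expr1 mulN1r !pi_stdE det3C.
- move=> p I j.
  have E i : [tuple if l == j then i else tnth I l | l < 2] =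
      [tuple if 0 == j then i else tnth I 0; if 1 == j then i else tnth I 1].
    by rewrite [LHS]tuple2_eta !tnth_mktuple.
  under eq_bigr do rewrite E pi_stdE mulrN.
  rewrite sumrN; apply/eqP; rewrite oppr_eq0; apply/eqP.
  case: j {E} => -[|[|//]] j2 /=; last under eq_bigr do rewrite det3C mulrN.
    exact: sum_det3_radial.
  by rewrite sumrN sum_det3_radial oppr0.
Qed.

End Bivectors.

(** * The Poisson differential of vector fields *)

Section VectorFields.
Variable R : realType.
Implicit Types (p : sphere R) (i j k : 'I_3) (c : R) (X : tfield R 1).
Local Notation e := (basis_coord R).

Lemma basis_coord_id i : e i i = 1. Proof. by rewrite /basis_coord eqxx. Qed.

Lemma mvfield1_tangent X p : mvfield X -> \sum_i xcoord i p * X p [tuple i] = 0.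
Proof.
move=> [_ _ /(_ p [tuple 0] 0) tX]; rewrite -[RHS]tX; apply: eq_bigr => i _.
congr (_ * X p _); apply: eq_from_tnth => l.
by rewrite tnth_mktuple !(ord1 l) eqxx.
Qed.

(** Tangency of [X] kills the radial part of the differential of a coordinate. *)
Lemma mvapp1_xcoord X i : mvfield X -> mvapp X [:: xcoord i] = X ^~ [tuple i].
Proof.
move=> hX; apply/funext => p; rewrite mvapp1E.
under eq_bigr do rewrite dpart_xcoord mulrBr.
rewrite sumrB (bigD1 i)//= [X in _ + X - _]big1 => [|j /negbTE ji]; last first.
  by rewrite /basis_coord eq_sym ji mulr0.
rewrite basis_coord_id mulr1 addr0.
under eq_bigr do rewrite mulrCA mulrA mulrC.
by rewrite -mulr_sumr mvfield1_tangent// mulr0 subr0.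
Qed.

(** The first term is [pi_c(dX_i, dx_j) - pi_c(dX_j, dx_i)]. The other two are minus the derivative
    along [X] of the component [pi_c(dx_i, dx_j)], split by the product rule. *)
Lemma dPoisson_pi_c_vector c X p i j : mvfield X ->
  let x := fun l => xcoord l p in
  dPoisson (pi_c c) X p [tuple i; j] =
  - (c - x 2) * (det3 x (fun l => dpart l (X ^~ [tuple i]) p) (e ^~ j)
                 - det3 x (fun l => dpart l (X ^~ [tuple j]) p) (e ^~ i))
  + (c - x 2) * (\sum_k X p [tuple k] * cross3 (e ^~ i) (e ^~ j) k)
  - X p [tuple 2] * det3 x (e ^~ i) (e ^~ j).
Proof.
move=> hX x; rewrite /dPoisson /schouten /= insertion21 insertion12.
rewrite !mvapp_pi_c_xcoord !mvapp1_xcoord// !mvapp_pi_c !mvapp_pi_std.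
have Ex k : (fun l => dpart l (xcoord k) p) = (fun l => e l k - x l * x k).
  by apply/funext => l; rewrite dpart_xcoord.
have sh f k : det3 x f (fun l => dpart l (xcoord k) p) = det3 x f (e ^~ k).
  by rewrite Ex -(det3_shift x f (e ^~ k) 0 (x k)) /det3; ring.
rewrite !sh !mvapp1E.
(* The radial part of the differential of this component is a multiple of the conormal covector, so
   it vanishes on [X]. *)
have XP i1 j1 :
  \sum_k X p [tuple k] * dpart k ((@pi_c R c)^~ [tuple i1; j1]) p =
  - (c - x 2) * (\sum_k X p [tuple k] * cross3 (e ^~ i1) (e ^~ j1) k)
  + X p [tuple 2] * det3 x (e ^~ i1) (e ^~ j1).
  transitivity (
     - (c - x 2) * (\sum_k X p [tuple k] * cross3 (e ^~ i1) (e ^~ j1) k)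
     + det3 x (e ^~ i1) (e ^~ j1) * (\sum_k X p [tuple k] * e k 2)
     + (pi_std p [tuple i1; j1] * (- (c - x 2) + x 2))
       * \sum_k xcoord k p * X p [tuple k]).
    rewrite !mulr_sumr -!big_split /=; apply: eq_bigr => k _.
    rewrite dpart_pi_c pi_coefE pi_stdE /x.
    move: (det3 _ _ _) (X p _) (cross3 _ _ _) (xcoord 2 p) (xcoord k p)
      (e k 2) => a b d h y z.
    ring.
  rewrite mvfield1_tangent// mulr0 addr0 [X in _ + _ * X](bigD1 2)//= [X in _
    + _ * (_ + X)]big1.
    by rewrite basis_coord_id mulr1 addr0 [X in _ + X]mulrC.
  by move=> k /negbTE k2; rewrite /basis_coord eq_sym k2 mulr0.
rewrite !XP -signr_odd /= expr0 mul1r (cross3C (e ^~ i)) (det3C x (e ^~ i)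
  (e ^~ j)).
have -> : \sum_k X p [tuple k] * (\- cross3 (e^~ i) (e^~ j)) k =
  - \sum_k X p [tuple k] * cross3 (e^~ i) (e^~ j) k.
  by rewrite -sumrN; apply: eq_bigr => k _; rewrite mulrN.
have -> : xcoord 2 p = x 2 by [].
move: (\sum_k _) (det3 x _ _) (det3 x _ _) (det3 x _ _) (X p _) (x 2) =>
  a1 a2 a3 a4 b d.
by field.
Qed.

(* [x 0 * E 2 1 - x 1 * E 2 0], where [E i j] is the component on [dx_i /\ dx_j]
   of [dPoisson (pi_c c) X = pi_std]: the contraction with dx_3 /\ d theta,
   multiplied by r^2 = x_1^2 + x_2^2. *)
Lemma flux_eq c X p : mvfield X -> dPoisson (pi_c c) X = @pi_std R ->
  let x := fun l => xcoord l p in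
  let X' := fun i => X p [tuple i] in
  let dX := fun l i => dpart l (X ^~ [tuple i]) p in
  let rot := fun i => x 0 * dX 1 i - x 1 * dX 0 i in
  (c - x 2) * ((x 0 ^+ 2 + x 1 ^+ 2) * dX 2 2
     - x 2 * (x 0 * dX 0 2 + x 1 * dX 1 2)
     + (x 0 * rot 1 - x 1 * rot 0 - x 0 * X' 0 - x 1 * X' 1))
  + X' 2 * (x 0 ^+ 2 + x 1 ^+ 2) = x 0 ^+ 2 + x 1 ^+ 2.
Proof.
move=> hX eX x X' dX rot.
have H i j : (- (c - x 2)
    * (det3 x (dX^~ i) (e ^~ j) - det3 x (dX^~ j) (e ^~ i))
  + (c - x 2) * (\sum_k X' k * cross3 (e ^~ i) (e ^~ j) k)
  - X' 2 * det3 x (e ^~ i) (e ^~ j) = - det3 x (e ^~ i) (e ^~ j)).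
  by rewrite -pi_stdE -eX dPoisson_pi_c_vector.
have := H 2 1; have := H 2 0; clear H; rewrite /rot.
clear rot; move: (x) (X') (dX); clear x X' dX => x X' dX.
rewrite !sum_ord3.
have [-> -> ->] := cross3E (e ^~ 2) (e ^~ 0).
have [-> -> ->] := cross3E (e ^~ 2) (e ^~ 1).
rewrite /det3; have [-> -> -> [-> -> [-> -> -> ->]]] := basis_coord3 R.
move: (x 0) (x 1) (x 2) (X' 0) (X' 1) (X' 2) => x0 x1 x2 y0 y1 y2.
move: (dX 0 0) (dX 0 1) (dX 0 2) (dX 1 0) (dX 1 1) (dX 1 2) (dX 2 0) (dX 2 1)
  (dX 2 2) => a b d a1 b1 d1 a2 b2 d2.
move=> E0 E1.
match type of E0 with ?l = ?r => match type of E1 with ?l' = ?r' =>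
transitivity (x0 * l' - x1 * l); [|rewrite E0 E1] end end; ring.
Qed.

End VectorFields.

(** * Averaging over the longitude *)

Section LinearODE.
Variable R : realType.

(** The quotient [k / f] has zero derivative inside the interval, so the mean value theorem gives it
    equal values at the ends. *)
Lemma proportional_of_wronskian0 (k k' f f' : R -> R) (a b : R) : a < b ->
  (forall u : R, is_derive u 1 k (k' u)) -> (forall u : R,
    is_derive u 1 f (f' u)) ->
  (forall u, u \in `[a, b] -> f u != 0) ->
  (forall u, u \in `]a, b[ -> k' u * f u = k u * f' u) ->
  k b * f a = k a * f b.
Proof.
move=> ab dk df f0 W.
pose q u := k u * (f u)^-1.
have dq u : u \in `[a, b] ->
    is_derive u 1 q ((k' u * f u - k u * f' u) / (f u) ^+ 2).
  move=> uab; have fu := f0 u uab.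
  apply: (is_derive_eq (is_deriveM (dk u) (is_deriveV fu (df u)))).
  by rewrite /GRing.scale /=; field.
have qE u : q u = k u / f u by [].
(* This forgets the body of [q], so that only [qE] unfolds it. *)
move: q dq qE => q dq qE.
have dq' u : u \in `]a,
  b[ -> is_derive u 1 q ((k' u * f u - k u * f' u) / (f u) ^+ 2).
  by move=> uab; apply: dq; exact: subset_itv_oo_cc uab.
have cq : {within `[a, b], continuous q}.
  by apply: derivable_within_continuous => u uab; have [] := dq u uab.
have [x xab] := MVT ab dq' cq.
rewrite W// subrr !mul0r => /eqP; rewrite subr_eq0 !qE => /eqP E.
have fa : f a != 0 by apply: f0; rewrite in_itv /= lexx ltW.
have fb : f b != 0 by apply: f0; rewrite in_itv /= lexx ltW.
by rewrite -[k b](divfK fb) E; field.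
Qed.

(** The functions [k] and [f = c - cos u] have zero Wronskian, so [k] is a multiple of [f] on each
    side of [acos c], with factors [k 0 / (c - 1)] on the left and [k 0 / (c + 1)] on the right. If
    [k 0 < 0], the first is positive and the second negative, while [f] increases through 0: [k]
    would have a corner at [acos c]. *)
Lemma singular_ode_no_solution (c : R) (k k' : R -> R) : `|c| < 1 ->
  (forall u : R, is_derive u 1 k (k' u)) ->
  (forall u, 0 < u < pi -> (c - cos u) * k' u = k u * sin u) ->
  k 0 = k pi -> 0 <= k 0.
Proof.
move=> c1 dk ode k0pi; rewrite leNgt; apply/negP => k0.
have /andP[cN1 c11] : -1 < c < 1 by rewrite -ltr_norml.
have cc : -1 <= c <= 1 by rewrite !ltW.
pose u0 := acos c.
have cu0 : cos u0 = c by rewrite acosK// in_itv.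
have u0_gt0 : 0 < u0 by rewrite acos_gt0// ltW.
have u0_ltpi : u0 < pi by rewrite acos_ltpi// cN1 ltW.
have s0 : 0 < sin u0 by rewrite sin_gt0_pi// u0_gt0.
have u0in : u0 \in `[0, pi] by rewrite in_itv /= !ltW.
pose f u := c - cos u.
have df (u : R) : is_derive u 1 f (sin u).
  by apply: (is_derive_eq (is_deriveB (is_derive_cst c u 1)
    (is_derive_cos u))); rewrite sub0r opprK.
have f_lt0 u : 0 <= u < u0 -> f u < 0.
  move=> /andP[u_ge0 uu0]; rewrite subr_lt0 -cu0 ltr_cos//.
  by rewrite in_itv /= u_ge0 (ltW (lt_trans uu0 _)).
have f_gt0 u : u0 < u <= pi -> 0 < f u.
  move=> /andP[u0u u_lepi]; rewrite subr_gt0 -cu0 ltr_cos//.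
  by rewrite in_itv /= u_lepi andbT (ltW (lt_trans _ u0u)).
have f0 : f 0 = c - 1 by rewrite /f cos0.
have fpi : f pi = c + 1 by rewrite /f cospi opprK.
have kl u : 0 < u < u0 -> k u * (c - 1) = k 0 * f u.
  move=> /andP[u_gt0 uu0].
  have := @proportional_of_wronskian0 k k' f sin 0 u u_gt0 dk df.
  rewrite f0 => -> //.
  - move=> v; rewrite in_itv /= => /andP[v0 vu]; apply/ltr0_neq0/f_lt0.
    by rewrite v0 (le_lt_trans vu).
  - move=> v; rewrite in_itv /= => /andP[v0 vu]; rewrite mulrC ode// v0.
    exact: lt_trans vu (lt_trans uu0 _).
have kr u : u0 < u < pi -> k u * (c + 1) = k 0 * f u.
  move=> /andP[u0u u_ltpi].
  have := @proportional_of_wronskian0 k k' f sin u pi u_ltpi dk df.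
  rewrite fpi -k0pi => <- //.
  - move=> v; rewrite in_itv /= => /andP[uv vpi]; apply/lt0r_neq0/f_gt0.
    by rewrite vpi (lt_le_trans u0u).
  - move=> v; rewrite in_itv /= => /andP[uv vpi]; rewrite mulrC ode// vpi andbT.
    exact: lt_trans (lt_trans _ u0u) uv.
have ku0 : k u0 = 0.
  have := ode u0; rewrite u0_gt0 u0_ltpi cu0 subrr mul0r => /(_ isT)/esym/eqP.
  by rewrite mulf_eq0 (gt_eqF s0) orbF => /eqP.
pose K := k 0 / (c - 1).
have K0 : 0 < K by rewrite ltr_ndivlMr ?subr_lt0// mul0r.
(* [k] lies below every line [s * f] with [0 <= s <= K] and touches it at [u0],
   so its derivative there takes all the values [s * sin u0]. *)
have max s : 0 <= s <= K -> k' u0 = s * sin u0.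
  move=> /andP[s_ge0 sK].
  pose m u := k u - s * f u.
  have dm (u : R) : is_derive u 1 m (k' u - s * sin u).
    apply: (is_derive_eq (is_deriveB (dk u) (is_deriveZ s (df u)))) => //.
  have m0 : m u0 = 0 by rewrite /m ku0 /f cu0 subrr mulr0 subrr.
  have [] := @derive1_at_max R m 0 pi u0 _ _ _ _.
  - exact: pi_ge0.
  - by move=> t _; have [] := dm t.
  - by rewrite in_itv /= u0_gt0.
  - move=> t; rewrite in_itv /= => /andP[t0 tpi]; rewrite m0 subr_le0.
    have [tu|ut|->] := ltgtP t u0; last by rewrite ku0 /f cu0 subrr mulr0.
    + have -> : k t = K * f t.
        have := kl t; rewrite t0 tu => /(_ isT) E; rewrite /K mulrAC -E mulfK//.
        by rewrite lt_eqF// subr_lt0.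
      by rewrite ler_wnM2r// ltW// f_lt0// tu ltW.
    + have ft : 0 < f t by rewrite f_gt0// ut ltW.
      (* To the right of [u0], [k] has the sign of [k 0], so 0 separates it from [s * f]. *)
      apply: (@le_trans _ _ 0); last by rewrite mulr_ge0// ltW.
      have c10 : 0 < c + 1 by rewrite -ltrBlDr sub0r.
      rewrite -(pmulr_lle0 _ c10) kr ?ut// pmulr_lle0// ltW//.
  - move=> _; rewrite (@derive_val _ _ _ _ _ _ _ (dm u0)) => /eqP.
    by rewrite subr_eq0 => /eqP.
have := max 0; rewrite lexx (ltW K0) mul0r => /(_ isT).
rewrite (max K) ?lexx ?ltW// => /eqP; rewrite mulf_eq0.
by rewrite (gt_eqF K0) (gt_eqF s0).
Qed.

End LinearODE.

(** * Integrals with a parameter *)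

Section UnderIntegral.
Variable R : realType.
Local Notation mu := (@lebesgue_measure R).

Lemma continuous_integrable_itv (f : R -> R) (l r : R) : continuous f ->
  mu.-integrable `[l, r] (EFin \o f).
Proof.
move=> cf; apply: continuous_compact_integrable; first exact: segment_compact.
exact: continuous_subspaceT.
Qed.

(** Differentiation under the integral, dominated by a constant: joint continuity bounds [a'] on the
    product of the compact intervals [[u - 1, u + 1]] and [[l, r]]. *)
Lemma is_derive_Rintegral (a a' : R -> R -> R) (l r : R) :
  (forall u v : R, is_derive u 1 (a ^~ v) (a' u v)) ->
  (forall u, continuous (a u)) ->
  continuous (fun w : R * R => a' w.1 w.2) ->
  forall u : R, is_derive u 1 (fun t => \int[mu]_(v in `[l, r]) a t v)
    (\int[mu]_(v in `[l, r]) a' u v).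
Proof.
move=> da ca ca' u.
have [M M0 HM] : exists2 M : R, 0 <= M &
    forall x y, x \in `]u - 1, u + 1[ -> y \in `[l, r] -> `|a' x y| <= M.
  have K : compact (`[u - 1, u + 1] `*` `[l, r] : set (R * R)).
    by apply: compact_setX; exact: segment_compact.
  have : compact ((fun w : R * R =>
    a' w.1 w.2) @` (`[u - 1, u + 1] `*` `[l, r])).
    by apply: continuous_compact => //; exact: continuous_subspaceT.
  (* Every number strictly above [N] is a bound; this one is also nonnegative. *)
  move=> /compact_bounded[N [_ HN]]; exists (`|N| + 1);
    first by rewrite addr_ge0.
  move=> x y xu yl; apply: (HN (`|N| + 1)).
    by rewrite (le_lt_trans (ler_norm _))// ltrDl.
  exists (x, y) => //=; split => //=; exact: subset_itv_oo_cc xu.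
have pE x y : partial1of2 a x y = a' x y.
  by rewrite partial1of2E; exact: derive_val.
have ui : `]u - 1, u + 1[%classic u by rewrite /= in_itv /= ltrBlDr ltrDl ltr01.
have hyp1 x : `]u - 1, u + 1[%classic x -> mu.-integrable `[l, r] (EFin \o a x).
  by move=> _; exact: continuous_integrable_itv.
have hyp2 x y : `]u - 1, u + 1[%classic x -> `[l,
  r]%classic y -> derivable (a ^~ y) x 1.
  by move=> _ _; have [] := da x y.
have hyp3 : mu.-integrable `[l, r] (EFin \o (cst M : R -> R)).
  by apply: continuous_integrable_itv; exact: cst_continuous.
have hyp4 x y : `]u - 1, u + 1[%classic x -> `[l,
  r]%classic y -> `|partial1of2 a x y| <= cst M y.
  by move=> xu yl; rewrite pE; exact: HM.
have dI := @derivable_under_integral R _ _ mu a `[l, r] (measurable_itv _)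
  u (u - 1) (u + 1) ui hyp1 hyp2 _ (fun=> M0) hyp3 hyp4.
have eI := @differentiation_under_integral R _ _ mu a `[l, r] (measurable_itv _)
  u (u - 1) (u + 1) ui hyp1 hyp2 _ (fun=> M0) hyp3 hyp4.
apply: DeriveDef => //.
rewrite -derive1E eI; apply: eq_Rintegral => y _; exact: pE.
Qed.

Lemma Rintegral_derive (F f : R -> R) (l r : R) : l < r -> continuous f ->
  (forall u : R, is_derive u 1 F (f u)) ->
  \int[mu]_(v in `[l, r]) f v = F r - F l.
Proof.
move=> lr cf dF.
have cF : continuous F.
  by move=> x; apply: differentiable_continuous; apply/derivable1_diffP;
    have [] := dF x.
rewrite /Rintegral (@continuous_FTC2 R f F l r lr) //.
- exact: continuous_subspaceT.
- split; first by move=> x _; have [] := dF x.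
  + exact/cvg_at_right_filter/cF.
  + exact/cvg_at_left_filter/cF.
- by move=> x _; rewrite derive1E; exact: derive_val.
Qed.

Lemma Rintegral_linear3 (A B C : R) (f g h : R -> R) (l r : R) :
  continuous f -> continuous g -> continuous h ->
  \int[mu]_(v in `[l, r]) (A * f v + B * g v + C * h v) =
  A * \int[mu]_(v in `[l, r]) f v + B * \int[mu]_(v in `[l, r]) g v
  + C * \int[mu]_(v in `[l, r]) h v.
Proof.
move=> cf cg ch.
have cZ k (F : R -> R) : continuous F -> continuous (fun v => k * F v).
  by move=> cF v; apply: cvgM; [exact: cvg_cst|exact: cF].
have iZ k (F : R -> R) : continuous F -> mu.-integrable `[l,
  r] (EFin \o (fun v => k * F v)).
  by move=> cF; exact: (continuous_integrable_itv l r (cZ k F cF)).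
have iD : mu.-integrable `[l, r] (EFin \o (fun v => A * f v + B * g v)).
  apply: (@continuous_integrable_itv (fun v => A * f v + B * g v)) => v.
  by apply: cvgD; exact: cZ.
rewrite (@RintegralD _ _ _ mu `[l, r] _ _ (measurable_itv _) iD (iZ C h ch)).
rewrite (@RintegralD _ _ _ mu `[l,
  r] _ _ (measurable_itv _) (iZ A f cf) (iZ B g cg)).
by rewrite !RintegralZl//; exact: continuous_integrable_itv.
Qed.

End UnderIntegral.

(** * Spherical coordinates *)

Section SphericalCoordinates.
Variable R : realType.
Local Notation mu := (@lebesgue_measure R).

(** The colatitude [u] and the longitude [v] range over the whole line; the poles are the points
    with [sin u = 0]. *)
Definition polar_vec (u v : R) : 'rV[R]_3 :=
  \row_(i < 3) [:: sin u * cos v; sin u * sin v; cos u]`_i.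

Lemma polar_subproof u v : sqnorm (polar_vec u v) == 1.
Proof.
rewrite /sqnorm sum_ord3 !mxE /= !exprMn -mulrDr cos2Dsin2 mulr1 addrC
  cos2Dsin2 //.
Qed.

Definition polar u v : sphere R := Sub (polar_vec u v) (polar_subproof u v).

Lemma xcoord_polar u v : [/\ xcoord 0 (polar u v) = sin u * cos v,
  xcoord 1 (polar u v) = sin u * sin v & xcoord 2 (polar u v) = cos u].
Proof. by split; rewrite /xcoord /= mxE. Qed.

Lemma ord3P (P : 'I_3 -> Prop) : P 0 -> P 1 -> P 2 -> forall i, P i.
Proof.
move=> P0 P1 P2 [[|[|[|//]]] i3].
- by rewrite (_ : Ordinal i3 = 0)//; exact: val_inj.
- by rewrite (_ : Ordinal i3 = 1)//; exact: val_inj.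
- by rewrite (_ : Ordinal i3 = 2)//; exact: val_inj.
Qed.

Lemma continuous_xcoord_polar (T : topologicalType) (s t : T -> R) :
  continuous s -> continuous t ->
  forall j, continuous (fun w => xcoord j (polar (s w) (t w))).
Proof.
move=> cs ct.
have csin (f : T -> R) : continuous f -> continuous (sin \o f).
  by move=> cf w; apply: continuous_comp; [exact: cf|exact: continuous_sin].
have ccos (f : T -> R) : continuous f -> continuous (cos \o f).
  by move=> cf w; apply: continuous_comp; [exact: cf|exact: continuous_cos].
apply: ord3P => w.
- rewrite (_ : (fun _ => _) = (sin \o s) \* (cos \o t)).
    by apply: continuousM; [exact: csin|exact: ccos].
  by apply/funext => y /=; have [-> _ _] := xcoord_polar (s y) (t y).
- rewrite (_ : (fun _ => _) = (sin \o s) \* (sin \o t)).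
    by apply: continuousM; exact: csin.
  by apply/funext => y /=; have [_ -> _] := xcoord_polar (s y) (t y).
- rewrite (_ : (fun _ => _) = (cos \o s)); first exact: ccos.
  by apply/funext => y /=; have [_ _ ->] := xcoord_polar (s y) (t y).
Qed.

Section Derivatives.
Variable f : sphere R -> R.
Hypothesis sf : smooth f.

Definition dcolat (u v : R) : R := let p := polar u v in
  cos u * cos v * dpart 0 f p
    + cos u * sin v * dpart 1 f p - sin u * dpart 2 f p.

Definition dlong (u v : R) : R := let p := polar u v in
  xcoord 0 p * dpart 1 f p - xcoord 1 p * dpart 0 f p.

Lemma is_derive_colat (u v : R) :
  is_derive u 1 (fun t => f (polar t v)) (dcolat u v).
Proof.
have H : forall i, is_derive u 1 (fun t => xcoord i (polar t v))
    [:: cos u * cos v; cos u * sin v; - sin u]`_i.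
  apply: ord3P.
  - rewrite (_ : (fun _ => _) = (fun t => sin t * cos v)).
      by apply: is_derive_eq; rewrite /GRing.scale /=; ring.
    by apply/funext => t; have [-> _ _] := xcoord_polar t v.
  - rewrite (_ : (fun _ => _) = (fun t => sin t * sin v)).
      by apply: is_derive_eq; rewrite /GRing.scale /=; ring.
    by apply/funext => t; have [_ -> _] := xcoord_polar t v.
  - rewrite (_ : (fun _ => _) = cos); first exact: is_derive_cos.
    by apply/funext => t; have [_ _ ->] := xcoord_polar t v.
apply: (is_derive_eq (is_derive_sphere sf H)).
by rewrite sum_ord3 /= mulNr.
Qed.

Lemma is_derive_long (u v : R) :
  is_derive v 1 (fun t => f (polar u t)) (dlong u v).
Proof.
have H : forall i, is_derive v 1 (fun t => xcoord i (polar u t))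
    [:: - (sin u * sin v); sin u * cos v; 0]`_i.
  apply: ord3P.
  - rewrite (_ : (fun _ => _) = (fun t => sin u * cos t)).
      by apply: is_derive_eq; rewrite /GRing.scale /=; ring.
    by apply/funext => t; have [-> _ _] := xcoord_polar u t.
  - rewrite (_ : (fun _ => _) = (fun t => sin u * sin t)).
      by apply: is_derive_eq; rewrite /GRing.scale /=; ring.
    by apply/funext => t; have [_ -> _] := xcoord_polar u t.
  - rewrite (_ : (fun _ => _) = cst (cos u)); first exact: is_derive_cst.
    by apply/funext => t; have [_ _ ->] := xcoord_polar u t.
apply: (is_derive_eq (is_derive_sphere sf H)).
rewrite sum_ord3 /= /dlong; have [-> -> _] := xcoord_polar u v.
by rewrite mul0r addr0 mulNr addrC.
Qed.

Lemma continuous_dcolat (T : topologicalType) (s t : T -> R) :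
  continuous s -> continuous t -> continuous (fun w => dcolat (s w) (t w)).
Proof.
move=> cs ct w.
have cd i := @dpart_continuous R T f i (fun w => polar (s w) (t w)) sf
  (continuous_xcoord_polar cs ct) w.
have csin (h : T -> R) : continuous h -> {for w, continuous (sin \o h)}.
  by move=> ch; apply: continuous_comp; [exact: ch|exact: continuous_sin].
have ccos (h : T -> R) : continuous h -> {for w, continuous (cos \o h)}.
  by move=> ch; apply: continuous_comp; [exact: ch|exact: continuous_cos].
apply: cvgB; first apply: cvgD.
- apply: cvgM; last exact: cd.
  by apply: cvgM; exact: ccos.
- apply: cvgM; last exact: cd.
  by apply: cvgM; [exact: ccos|exact: csin].
- by apply: cvgM; [exact: csin|exact: cd].
Qed.

Lemma continuous_dlong (u : R) : continuous (dlong u).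
Proof.
move=> w.
have cx : forall j, continuous (fun v => xcoord j (polar u v)).
  by apply: (@continuous_xcoord_polar R (fun=> u) id) => v;
    [exact: cvg_cst|exact: cvg_id].
have cd i := @dpart_continuous R R f i (polar u) sf cx w.
apply: cvgB; apply: cvgM; first [exact: cx|exact: cd].
Qed.

End Derivatives.

(** * The averaged equation and the contradiction *)

Section Flux.
Variables (c : R) (X : tfield R 1).
Hypotheses (hX : mvfield X) (eX : dPoisson (pi_c c) X = @pi_std R).

Let a i (p : sphere R) : R := X p [tuple i].
Let sa i : smooth (a i). Proof. by have [+ _ _] := hX; apply. Qed.
(** The pairing of [X] with [r^2 d theta], where [r^2 = x_1^2 + x_2^2]; unlike [d theta], this form
    is smooth at the poles. *)
Let rot_density (u v : R) : R :=
  let p := polar u v in xcoord 0 p * a 1 p - xcoord 1 p * a 0 p.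
(** The inner bracket with [rot] in [flux_eq]. Being an exact derivative in the longitude, it
    disappears on averaging. *)
Let drot_density (u v : R) : R := let p := polar u v in
  xcoord 0 p * dlong (a 1) u v - xcoord 1 p * dlong (a 0) u v
  - xcoord 0 p * a 0 p - xcoord 1 p * a 1 p.

Let is_derive_rot_density (u v : R) :
  is_derive v 1 (rot_density u) (drot_density u v).
Proof.
have d0 := is_derive_long (sa 0) u v; have d1 := is_derive_long (sa 1) u v.
have x0 : is_derive v 1
    (fun t => xcoord 0 (polar u t)) (- xcoord 1 (polar u v)).
  rewrite (_ : (fun _ => _) = (fun t => sin u * cos t)).
    have [_ -> _] := xcoord_polar u v.
    by apply: is_derive_eq; rewrite /GRing.scale /=; ring.
  by apply/funext => t; have [-> _ _] := xcoord_polar u t.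
have x1 : is_derive v 1 (fun t => xcoord 1 (polar u t)) (xcoord 0 (polar u v)).
  rewrite (_ : (fun _ => _) = (fun t => sin u * sin t)).
    have [-> _ _] := xcoord_polar u v.
    by apply: is_derive_eq; rewrite /GRing.scale /=; ring.
  by apply/funext => t; have [_ -> _] := xcoord_polar u t.
apply: (is_derive_eq (is_deriveB (is_deriveM x0 d1) (is_deriveM x1 d0))).
rewrite /GRing.scale /= /drot_density.
move: (dlong _ _ _) (dlong _ _ _) (xcoord _ _) (xcoord _ _) (a _ _) (a _ _)
  => y1 y2 y3 y4 y5 y6.
ring.
Qed.

Let continuous_drot_density (u : R) : continuous (drot_density u).
Proof.
move=> w.
have cx : forall j, continuous (fun v => xcoord j (polar u v)).
  by apply: (@continuous_xcoord_polar R (fun=> u) id) => v;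
    [exact: cvg_cst|exact: cvg_id].
have ca i : {for w, continuous (fun v => a i (polar u v))}.
  apply: differentiable_continuous; apply/derivable1_diffP.
  by have [] := is_derive_long (sa i) u w.
apply: cvgB; first apply: cvgB; first apply: cvgB.
all: apply: cvgM; first exact: cx.
all: first [exact: ca | exact: continuous_dlong].
Qed.

Let height (u v : R) : R := a 2 (polar u v).

(** In [flux_eq] the terms with [dX l 2] outside [rot] combine to [- sin u * dcolat]. *)
Let flux_polar (u v : R) :
  - (c - cos u) * sin u * dcolat (a 2) u v + (c - cos u) * drot_density u v
  + sin u ^+ 2 * height u v = sin u ^+ 2.
Proof.
have := flux_eq (polar u v) hX eX; rewrite /=.
rewrite /drot_density /dlong /dcolat /height /a /=.
have [-> -> ->] := xcoord_polar u v.
move: (dpart 0 (X^~ [tuple 0]) _) (dpart 1 (X^~ [tuple 0]) _) => d00 d10.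
move: (dpart 0 (X^~ [tuple 1]) _) (dpart 1 (X^~ [tuple 1]) _) => d01 d11.
move: (dpart 0 (X^~ [tuple 2]) _) (dpart 1 (X^~ [tuple 2]) _) (dpart 2 (X^~
  [tuple 2]) _) => d02 d12 d22.
move: (X _ [tuple 0]) (X _ [tuple 1]) (X _ [tuple 2]) => X0 X1 X2.
rewrite !exprMn -mulrDr cos2Dsin2 mulr1 => E; rewrite -[RHS]E. 
ring.
Qed.

Lemma no_primitive_vector : `|c| < 1 -> False.
Proof.
move=> c1.
have pi2 : 0 < pi *+ 2 :> R by rewrite pmulrn_lgt0 ?pi_gt0.
(* The integral is not divided by the length of the period, so the constant 1 of the averaged
   equation becomes [pi *+ 2]. *)
pose h u := \int[mu]_(v in `[0, pi *+ 2]) height u v.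
pose h' u := \int[mu]_(v in `[0, pi *+ 2]) dcolat (a 2) u v.
have ch u : continuous (height u).
  move=> v; apply: differentiable_continuous; apply/derivable1_diffP.
  by have [] := is_derive_long (sa 2) u v.
have cdh u : continuous (dcolat (a 2) u).
  by apply: (@continuous_dcolat _ (sa 2) R (fun=> u) id) => v;
    [exact: cvg_cst|exact: cvg_id].
have dh (u : R) : is_derive u 1 h (h' u).
  apply: is_derive_Rintegral => //.
  - by move=> s t; exact: is_derive_colat.
  - by apply: (continuous_dcolat (sa 2)) => w; [exact: cvg_fst|exact: cvg_snd].
(* The integral of a longitudinal derivative over a full period. *)
have rot0 u : \int[mu]_(v in `[0, pi *+ 2]) drot_density u v = 0.
  rewrite (Rintegral_derive pi2 (@continuous_drot_density u)
    (is_derive_rot_density u)).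
  rewrite /rot_density (_ : polar u (pi *+ 2) = polar u 0) ?subrr//.
  apply/val_inj/rowP => i; rewrite !mxE.
  by rewrite -[pi *+ 2]add0r cosD2pi sinD2pi.
have leb : fine (mu `[0, pi *+ 2]) = pi *+ 2.
  by rewrite lebesgue_measure_itv /= lte_fin pi2 -EFinB subr0.
have avg u : - (c - cos u) * sin u * h' u + sin u ^+ 2 * h u = sin u ^+ 2 *
  (pi *+ 2).
  rewrite -leb -Rintegral_cst; last exact: measurable_itv.
  have := Rintegral_linear3 (- (c - cos u) * sin u) (c - cos u)
    (sin u ^+ 2) 0 (pi *+ 2)
    (cdh u) (@continuous_drot_density u) (ch u).
  rewrite rot0 mulr0 addr0 => <-.
  by apply: eq_Rintegral => v _; rewrite flux_polar.
(* At a pole the position vector is vertical, so tangency makes the third component of [X]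
   vanish. *)
have h0 u : sin u = 0 -> h u = 0.
  move=> su; rewrite /h -[RHS](mul0r (fine (mu `[0,
    pi *+ 2]))) -Rintegral_cst; last exact: measurable_itv.
  apply: eq_Rintegral => v _.
  have := mvfield1_tangent (polar u v) hX; rewrite sum_ord3.
  have [-> -> ->] := xcoord_polar u v.
  rewrite su !mul0r !add0r => /eqP; rewrite mulf_eq0 => /orP[/eqP cu|/eqP//].
  by have := cos2Dsin2 u; rewrite su cu expr0n addr0 => /esym/eqP;
    rewrite oner_eq0.
(* Subtracting the constant solution [pi *+ 2] makes the equation homogeneous, with the negative
   value [- (pi *+ 2)] at both poles. *)
have := @singular_ode_no_solution R c (fun u => h u - pi *+ 2) h' c1.
rewrite (h0 0) ?sin0// (h0 pi) ?sinpi// => H.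
suff : 0 <= 0 - pi *+ 2 :> R by rewrite sub0r oppr_ge0 leNgt pi2.
apply: H => //.
- by move=> u; apply: (is_derive_eq (is_deriveB (dh u) (is_derive_cst
  (pi *+ 2) u 1))); rewrite subr0.
- move=> u u0pi; have su : sin u != 0 by rewrite gt_eqF// sin_gt0_pi.
  (* The averaged equation carries an extra factor [sin u], which is nonzero strictly between the
     poles. *)
  apply: (mulfI su); have := avg u;
    move: (h u) (h' u) (sin u) (c - cos u) (pi *+ 2) => x1 x2 x3 x4 x5 E.
  by transitivity (x3 ^+ 2 * x1 - x3 ^+ 2 * x5); [rewrite -E|]; ring.
Qed.

End Flux.

End SphericalCoordinates.

(** * The zero field and the conclusion *)

Lemma cst0_affine (R : realType) :
  (fun=> 0) = (fun p : sphere R => affine 0 (fun=> 0) (val p)).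
Proof. by apply/funext => p; rewrite /affine big1 ?addr0// => j _;
  rewrite mul0r. Qed.

Lemma mvfield0 (R : realType) k : mvfield (0 : tfield R k).
Proof.
split.
- by move=> I; rewrite cst0_affine; exact: smooth_affine.
- by move=> p I s; rewrite mulr0.
- by move=> p I j; rewrite big1// => i _; rewrite mulr0.
Qed.

Lemma dPoisson_pi_c0 (R : realType) (c : R) : dPoisson (pi_c c) (0
  : tfield R 1) = 0.
Proof.
apply/funext => p; apply/funext => I.
rewrite (tuple2_eta (I : 2.-tuple _)) dPoisson_pi_c_vector;
  last exact: mvfield0.
have d0 l : dpart l (fun _ : sphere R => 0) p = 0.
  by rewrite cst0_affine dpart_affine big1 ?mulr0 ?subr0// => j _;
    rewrite mul0r.
have D0 i g : det3 (fun l => xcoord l p)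
    (fun l => dpart l ((0 : tfield R 1)^~ [tuple i]) p) g = 0.
  by rewrite /det3 !d0 !mul0r !subrr !mulr0 !addr0.
rewrite !D0 subrr mulr0 add0r mul0r subr0 big1 ?mulr0// => k _; exact: mul0r.
Qed.

Theorem lemma3p1 (R : realType) (c : R) (hc : `|c| < 1) :
  poisson_cohomology (pi_c c) (coh_class (pi_c c) (@pi_std R)) /\
  coh_class (pi_c c) (@pi_std R) <> coh_class (pi_c c) 0.
Proof.
have pi_cocycle : cocycle (pi_c c) (@pi_std R).
  by split; [exact: mvfield_pi_std|exact: dPoisson_pi_c_pi_std].
split; first by exists (@pi_std R).
move=> classE.
(* [pi_std] lies in its own class, as the difference 0 is the differential of the zero field. Were
   this the class of 0, [pi_std] would itself be [dPoisson (pi_c c) X] for a vector field [X]. *)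
have : coh_class (pi_c c) (@pi_std R) (@pi_std R).
  split=> //; exists 0; first exact: mvfield0.
  by rewrite dPoisson_pi_c0 subrr.
rewrite classE => -[_ [X hX]]; rewrite subr0 => eX.
exact: no_primitive_vector hX eX hc.
Qed.
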